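(* Let $\Bbbk$ be a field of characteristic zero and let $(\mathcal{C},\otimes,I,a,\ell,r,\sigma,t)$ be a $\Bbbk$-linear pre-Cartier category satisfying $$[t^{12}_{X,Y,Z},t^{23}_{X,Y,Z}]=0$$ for all objects $X,Y,Z$, where $t^{12}_{X,Y,Z}=t_{X,Y}\otimes\mathrm{id}_Z$ and $t^{23}_{X,Y,Z}=a_{X,Y,Z}^{-1}\circ(\mathrm{id}_X\otimes t_{Y,Z})\circ a_{X,Y,Z}$. Consider the $\Bbbk[[\hbar]]$-linear category with the same objects as $\mathcal{C}$ and morphism spaces $\mathrm{Hom}_{\mathcal{C}}(X,Y)[[\hbar]]$, and let $\tilde\otimes,\tilde a,\tilde\ell,\tilde r,\tilde\sigma$ be the $\hbar$-linear extensions of $\otimes,a,\ell,r,\sigma$. Then this category, with tensor product $\tilde\otimes$, unit $I$, constraints $\tilde a,\tilde\ell,\tilde r$ and braiding $$\hat\sigma_{X,Y}=\tilde\sigma_{X,Y}\circ e^{\frac{\hbar}{2}t_{X,Y}},$$ is a braided monoidal category.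
   Context: A $\Bbbk$-linear pre-Cartier category is a $\Bbbk$-linear braided monoidal category (enriched over $\Bbbk$-vector spaces, $\otimes$ being $\Bbbk$-bilinear on morphisms; $a_{X,Y,Z}\colon(X\otimes Y)\otimes Z\to X\otimes(Y\otimes Z)$, $\sigma_{X,Y}\colon X\otimes Y\to Y\otimes X$, not assumed symmetric) with a natural transformation $t\colon\otimes\Rightarrow\otimes$ (infinitesimal braiding) such that for all objects $X,Y,Z$ $$t_{X,Y\otimes Z}=a_{X,Y,Z}(t_{X,Y}\otimes\mathrm{id}_Z)a_{X,Y,Z}^{-1}+a_{X,Y,Z}(\sigma_{X,Y}^{-1}\otimes\mathrm{id}_Z)a_{Y,X,Z}^{-1}(\mathrm{id}_Y\otimes t_{X,Z})a_{Y,X,Z}(\sigma_{X,Y}\otimes\mathrm{id}_Z)a_{X,Y,Z}^{-1},$$ $$t_{X\otimes Y,Z}=a_{X,Y,Z}^{-1}(\mathrm{id}_X\otimes t_{Y,Z})a_{X,Y,Z}+a_{X,Y,Z}^{-1}(\mathrm{id}_X\otimes\sigma_{Y,Z}^{-1})a_{X,Z,Y}(t_{X,Z}\otimes\mathrm{id}_Y)a_{X,Z,Y}^{-1}(\mathrm{id}_X\otimes\sigma_{Y,Z})a_{X,Y,Z}.$$ Composition in the category with Homs $\mathrm{Hom}_{\mathcal{C}}(X,Y)[[\hbar]]$ is $\big(\sum_k\phi_k\hbar^k\big)\circ\big(\sum_k\psi_k\hbar^k\big)=\sum_k\big(\sum_{i=0}^k\phi_i\circ\psi_{k-i}\big)\hbar^k$;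 $\tilde\otimes$ agrees with $\otimes$ on objects and is the $\hbar$-adically continuous bilinear extension of $\otimes$ on morphisms. *)

(* Defs.v *)
From HB Require Import structures.
From mathcomp Require Import all_boot all_order all_algebra.
From mathcomp Require Import boolp.

Set Implicit Arguments.
Unset Strict Implicit.
Unset Printing Implicit Defensive.

Import GRing.Theory.

Declare Scope lincat_scope.
Delimit Scope lincat_scope with C.
Local Open Scope ring_scope.
Local Open Scope lincat_scope.

(** [fps V] is V[[ħ]]; [f n] is the coefficient of ħ^n. *)
Definition fps (V : Type) : Type := nat -> V.

HB.instance Definition _ (V : choiceType) := Choice.copy (fps V) (nat -> V).

(** The continuous extension of a bilinear map [m] to power series:
    (Σ u_i ħ^i, Σ v_j ħ^j) |-> Σ_n (Σ_(i <= n) m u_i v_(n-i)) ħ^n.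
    The product of k[[ħ]], its action on V[[ħ]], the composition of morphisms
    and the tensor product of morphisms are all of this form. *)
Definition cauchy (U V : Type) (W : nmodType) (m : U -> V -> W)
    (u : fps U) (v : fps V) : fps W :=
  fun n => \sum_(i < n.+1) m (u i) (v (n - i)%N).

Definition hconst (V : nmodType) (x : V) : fps V :=
  fun n => if n is 0 then x else 0.

Section FpsZmodule.
Variable V : zmodType.

Definition fps_zero : fps V := fun=> 0.
Definition fps_opp (u : fps V) : fps V := fun n => - u n.
Definition fps_add (u v : fps V) : fps V := fun n => u n + v n.

Fact fps_addA : associative fps_add.
Proof. by move=> u v w; apply: funext => n; rewrite /fps_add addrA. Qed.
Fact fps_addC : commutative fps_add.
Proof. by move=> u v; apply: funext => n; rewrite /fps_add addrC. Qed.
Fact fps_add0 : left_id fps_zero fps_add.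
Proof. by move=> u; apply: funext => n; rewrite /fps_add add0r. Qed.
Fact fps_addN : left_inverse fps_zero fps_opp fps_add.
Proof. by move=> u; apply: funext => n; rewrite /fps_add addNr. Qed.

HB.instance Definition _ :=
  GRing.isZmodule.Build (fps V) fps_addA fps_addC fps_add0 fps_addN.

Lemma fpsD (u v : fps V) n : (u + v) n = u n + v n. Proof. by []. Qed.
Lemma fps0 n : (0 : fps V) n = 0. Proof. by []. Qed.

End FpsZmodule.

Section Cauchy.
Variables (U V W : nmodType).

Lemma cauchy_hconstl (m : U -> V -> W) (x : U) (v : fps V) :
  (forall y, m 0 y = 0) -> cauchy m (hconst x) v = fun n => m x (v n).
Proof.
move=> m0; apply: funext => n; rewrite /cauchy big_ord_recl /= subn0.
by rewrite big1 ?addr0.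
Qed.

Lemma cauchy_hconstr (m : U -> V -> W) (u : fps U) (y : V) :
  (forall x, m x 0 = 0) -> cauchy m u (hconst y) = fun n => m (u n) y.
Proof.
move=> m0; apply: funext => n; rewrite /cauchy big_ord_recr /= subnn.
rewrite big1 ?add0r // => i _.
by case E: (n - i)%N => [|j]; rewrite ?m0 //; move: (ltn_ord i); rewrite -subn_gt0 E.
Qed.

Lemma cauchyC (T1 T2 : Type) (m : T1 -> T2 -> W) u v :
  cauchy m u v = cauchy (fun y x => m x y) v u.
Proof.
apply: funext => n; rewrite /cauchy (reindex_inj rev_ord_inj) /=.
by apply: eq_bigr => i _; rewrite subSS subKn // -ltnS.
Qed.

End Cauchy.

Lemma cauchyA (T1 T2 T3 : Type) (U V W : nmodType)
    (m12 : T1 -> T2 -> U) (mU : U -> T3 -> W)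
    (m23 : T2 -> T3 -> V) (mV : T1 -> V -> W) u v w :
  (forall z, mU 0 z = 0) -> (forall z, {morph mU^~ z : x y / x + y}) ->
  (forall x, mV x 0 = 0) -> (forall x, {morph mV x : y z / y + z}) ->
  (forall x y z, mU (m12 x y) z = mV x (m23 y z)) ->
  cauchy mU (cauchy m12 u v) w = cauchy mV u (cauchy m23 v w).
Proof.
move=> mU0 mUD mV0 mVD mE; apply: funext => n; rewrite /cauchy.
pose F (i j : nat) := mV (u i) (m23 (v (j - i)%N) (w (n - j)%N)).
transitivity (\sum_(j < n.+1) \sum_(i < n.+1 | (i <= j)%N) F i j).
  apply: eq_bigr => j _; rewrite (big_morph _ (mUD _) (mU0 _)).
  rewrite (eq_bigr (fun i : 'I_j.+1 => F i j)); last by move=> i _; exact: mE.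
  by rewrite (big_ord_narrow_leq (leq_ord j)).
rewrite (exchange_big_dep predT) //=; apply: eq_bigr => i _.
rewrite (big_morph _ (mVD _) (mV0 _)).
transitivity (\sum_(i <= j < n.+1) F i j); first by rewrite big_geq_mkord.
rewrite -{1}[nat_of_ord i]add0n big_addn subSn ?leq_ord // big_mkord.
by apply: eq_bigr => j _; rewrite /F addnK [(j + i)%N]addnC subnDA.
Qed.

Section FpsRing.
Variable R : comNzRingType.

Definition fps_mul : fps R -> fps R -> fps R := cauchy *%R.

Fact fps_mulA : associative fps_mul.
Proof.
by move=> u v w; rewrite /fps_mul -(cauchyA (m12 := *%R) (mU := *%R)) //;
  [move=> z; exact: mul0r | move=> z x y; exact: mulrDl
  |move=> z; exact: mulr0 | move=> z x y; exact: mulrDr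
  |move=> x y z; rewrite mulrA].
Qed.
Fact fps_mulC : commutative fps_mul.
Proof.
move=> u v; rewrite /fps_mul cauchyC; apply: funext => n.
by apply: eq_bigr => i _; rewrite mulrC.
Qed.
Fact fps_mul1 : left_id (hconst 1) fps_mul.
Proof.
move=> u; rewrite /fps_mul cauchy_hconstl; last exact: mul0r.
by apply: funext => n; rewrite mul1r.
Qed.
Fact fps_mulDl : left_distributive fps_mul +%R.
Proof.
move=> u v w; apply: funext => n; rewrite fpsD /fps_mul /cauchy -big_split /=.
by apply: eq_bigr => i _; rewrite fpsD mulrDl.
Qed.
Fact fps_oner_neq0 : hconst 1 != 0 :> fps R.
Proof.
apply/eqP => /(congr1 (fun u : fps R => u 0%N)) /eqP.
by rewrite fps0 /= oner_eq0.
Qed.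

HB.instance Definition _ := GRing.Zmodule_isComNzRing.Build (fps R)
  fps_mulA fps_mulC fps_mul1 fps_mulDl fps_oner_neq0.

Variable V : lmodType R.

Definition fps_scale : fps R -> fps V -> fps V := cauchy *:%R.

Fact fps_scaleA a b v : fps_scale a (fps_scale b v) = fps_scale (a * b) v.
Proof.
by rewrite /fps_scale -(cauchyA (m12 := *%R) (mU := *:%R)) //;
  [move=> z; exact: scale0r | move=> z x y; exact: scalerDl
  |move=> z; exact: scaler0 | move=> z x y; exact: scalerDr
  |move=> x y z; rewrite scalerA].
Qed.
Fact fps_scale1 : left_id 1 fps_scale.
Proof.
move=> u; rewrite /fps_scale cauchy_hconstl; last exact: scale0r.
by apply: funext => n; rewrite scale1r.
Qed.
Fact fps_scaleDr : right_distributive fps_scale +%R.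
Proof.
move=> a u v; apply: funext => n; rewrite fpsD /fps_scale /cauchy -big_split.
by apply: eq_bigr => i _; rewrite fpsD scalerDr.
Qed.
Fact fps_scaleDl v : {morph fps_scale^~ v : a b / a + b}.
Proof.
move=> a b; apply: funext => n; rewrite fpsD /fps_scale /cauchy -big_split.
by apply: eq_bigr => i _; rewrite fpsD scalerDl.
Qed.

HB.instance Definition _ := GRing.Zmodule_isLmodule.Build (fps R) (fps V)
  fps_scaleA fps_scale1 fps_scaleDr fps_scaleDl.

End FpsRing.

Lemma cauchy_linearl (R : comNzRingType) (U V W : lmodType R)
    (m : U -> V -> W) (v : fps V) :
  (forall y, linear (m^~ y)) -> linear (fun u : fps U => cauchy m u v).
Proof.
move=> ml a u u'.
have m0 y : m 0 y = 0.
  by have := ml y (-1) 0 0; rewrite !scaleN1r !addNr.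
have mD y : {morph m^~ y : p q / p + q}.
  by move=> p q; have := ml y 1 p q; rewrite !scale1r.
have mZ c x y : m (c *: x) y = c *: m x y by have := ml y c x 0; rewrite m0 !addr0.
transitivity (cauchy m (a *: u) v + cauchy m u' v).
  apply: funext => n; rewrite fpsD /cauchy -big_split /=.
  by apply: eq_bigr => i _; rewrite fpsD mD.
congr (_ + _); rewrite {1}/GRing.scale /= /fps_scale.
by apply: cauchyA => // [x|c]; [exact: scaler0 | exact: scalerDr].
Qed.

Lemma cauchy_linearr (R : comNzRingType) (U V W : lmodType R)
    (m : U -> V -> W) (u : fps U) :
  (forall x, linear (m x)) -> linear (fun v : fps V => cauchy m u v).
Proof.
move=> ml a v v'; rewrite [LHS]cauchyC [cauchy m u v]cauchyC.
by rewrite [cauchy m u v']cauchyC; exact: cauchy_linearl.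
Qed.

Record lincat (R : comNzRingType) := LinCat {
  ob :> Type;
  Mor : ob -> ob -> lmodType R;
  idmor : forall X, Mor X X;
  mcomp : forall X Y Z, Mor Y Z -> Mor X Y -> Mor X Z;
  mcomp1m : forall X Y (f : Mor X Y), mcomp (idmor Y) f = f;
  mcompm1 : forall X Y (f : Mor X Y), mcomp f (idmor X) = f;
  mcompA : forall W X Y Z (h : Mor Y Z) (g : Mor X Y) (f : Mor W X),
    mcomp h (mcomp g f) = mcomp (mcomp h g) f;
  mcomp_linearl : forall X Y Z (f : Mor X Y), linear (fun g : Mor Y Z => mcomp g f);
  mcomp_linearr : forall X Y Z (g : Mor Y Z), linear (fun f : Mor X Y => mcomp g f)
}.

Arguments Mor {R C} X Y : rename.
Arguments idmor {R C} X : rename.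
Arguments mcomp {R C X Y Z} g f : rename.

Notation "g ∘ f" := (mcomp g f) (at level 40, left associativity) : lincat_scope.

Section Isomorphisms.
Variables (R : comNzRingType) (C : lincat R).

Definition is_iso (X Y : C) (f : Mor X Y) : Prop :=
  exists g : Mor Y X, g ∘ f = idmor X /\ f ∘ g = idmor Y.

Definition iso_inv (X Y : C) (f : Mor X Y) (f_iso : is_iso f) : Mor Y X :=
  projT1 (cid f_iso).

Lemma iso_invP (X Y : C) (f : Mor X Y) (f_iso : is_iso f) :
  iso_inv f_iso ∘ f = idmor X /\ f ∘ iso_inv f_iso = idmor Y.
Proof. by rewrite /iso_inv; case: cid. Qed.

Definition mpow (X : C) (f : Mor X X) (n : nat) : Mor X X :=
  iter n (mcomp f) (idmor X).

Definition mcommutator (X : C) (f g : Mor X X) : Mor X X := f ∘ g - g ∘ f.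

End Isomorphisms.

Record braided_data (R : comNzRingType) (C : lincat R) := BraidedData {
  tob : C -> C -> C;
  tmor : forall X X' Y Y' : C,
    Mor X X' -> Mor Y Y' -> Mor (tob X Y) (tob X' Y');
  unit_ob : C;
  assoc : forall X Y Z : C, Mor (tob (tob X Y) Z) (tob X (tob Y Z));
  lunit : forall X : C, Mor (tob unit_ob X) X;
  runit : forall X : C, Mor (tob X unit_ob) X;
  braid : forall X Y : C, Mor (tob X Y) (tob Y X)
}.

Arguments tmor {R C} D {X X' Y Y'} f g : rename.

Section Braided.
Variables (R : comNzRingType) (C : lincat R) (D : braided_data C).

Local Notation "X ⊗ Y" := (tob D X Y) (at level 38, left associativity).
Local Notation "f ⊠ g" := (tmor D f g) (at level 38, left associativity).
Local Notation a := (assoc D).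
Local Notation σ := (braid D).
Local Notation I := (unit_ob D).

Record is_braided_monoidal : Prop := IsBraidedMonoidal {
  tens_id : forall X Y : C, idmor X ⊠ idmor Y = idmor (X ⊗ Y);
  tens_comp : forall (X X' X'' Y Y' Y'' : C) (f' : Mor X' X'') (f : Mor X X')
      (g' : Mor Y' Y'') (g : Mor Y Y'),
    (f' ∘ f) ⊠ (g' ∘ g) = (f' ⊠ g') ∘ (f ⊠ g);
  assoc_nat : forall (X X' Y Y' Z Z' : C)
      (f : Mor X X') (g : Mor Y Y') (h : Mor Z Z'),
    a X' Y' Z' ∘ ((f ⊠ g) ⊠ h) = (f ⊠ (g ⊠ h)) ∘ a X Y Z;
  assoc_iso : forall X Y Z : C, is_iso (a X Y Z);
  lunit_nat : forall (X X' : C) (f : Mor X X'),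
    lunit D X' ∘ (idmor I ⊠ f) = f ∘ lunit D X;
  lunit_iso : forall X : C, is_iso (lunit D X);
  runit_nat : forall (X X' : C) (f : Mor X X'),
    runit D X' ∘ (f ⊠ idmor I) = f ∘ runit D X;
  runit_iso : forall X : C, is_iso (runit D X);
  pentagon : forall W X Y Z : C,
    a W X (Y ⊗ Z) ∘ a (W ⊗ X) Y Z =
      (idmor W ⊠ a X Y Z) ∘ a W (X ⊗ Y) Z ∘ (a W X Y ⊠ idmor Z);
  triangle : forall X Y : C,
    (idmor X ⊠ lunit D Y) ∘ a X I Y = runit D X ⊠ idmor Y;
  braid_nat : forall (X X' Y Y' : C) (f : Mor X X') (g : Mor Y Y'),
    σ X' Y' ∘ (f ⊠ g) = (g ⊠ f) ∘ σ X Y;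
  braid_iso : forall X Y : C, is_iso (σ X Y);
  hexagon1 : forall X Y Z : C,
    a Y Z X ∘ σ X (Y ⊗ Z) ∘ a X Y Z =
      (idmor Y ⊠ σ X Z) ∘ a Y X Z ∘ (σ X Y ⊠ idmor Z);
  hexagon2 : forall X Y Z : C,
    iso_inv (assoc_iso Z X Y) ∘ σ (X ⊗ Y) Z ∘ iso_inv (assoc_iso X Y Z) =
      (σ X Z ⊠ idmor Y) ∘ iso_inv (assoc_iso X Z Y) ∘ (idmor X ⊠ σ Y Z)
}.

Definition tensor_bilinear : Prop :=
  (forall (X X' Y Y' : C) (g : Mor Y Y'), linear (fun f : Mor X X' => f ⊠ g)) /\
  (forall (X X' Y Y' : C) (f : Mor X X'), linear (fun g : Mor Y Y' => f ⊠ g)).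

Variable t : forall X Y : C, Mor (X ⊗ Y) (X ⊗ Y).

Definition t12 (X Y Z : C) : Mor (X ⊗ Y ⊗ Z) (X ⊗ Y ⊗ Z) := t X Y ⊠ idmor Z.

Definition t23 (DP : is_braided_monoidal) (X Y Z : C) :
    Mor (X ⊗ Y ⊗ Z) (X ⊗ Y ⊗ Z) :=
  iso_inv (assoc_iso DP X Y Z) ∘ (idmor X ⊠ t Y Z) ∘ a X Y Z.

Record is_pre_cartier : Prop := IsPreCartier {
  pc_braided : is_braided_monoidal;
  pc_bilinear : tensor_bilinear;
  pc_nat : forall (X X' Y Y' : C) (f : Mor X X') (g : Mor Y Y'),
    t X' Y' ∘ (f ⊠ g) = (f ⊠ g) ∘ t X Y;
  pc_tens_r : forall X Y Z : C,
    let ai X Y Z := iso_inv (assoc_iso pc_braided X Y Z) in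
    let σi X Y := iso_inv (braid_iso pc_braided X Y) in
    t X (Y ⊗ Z) =
      a X Y Z ∘ (t X Y ⊠ idmor Z) ∘ ai X Y Z
      + a X Y Z ∘ (σi X Y ⊠ idmor Z) ∘ ai Y X Z ∘ (idmor Y ⊠ t X Z)
          ∘ a Y X Z ∘ (σ X Y ⊠ idmor Z) ∘ ai X Y Z;
  pc_tens_l : forall X Y Z : C,
    let ai X Y Z := iso_inv (assoc_iso pc_braided X Y Z) in
    let σi X Y := iso_inv (braid_iso pc_braided X Y) in
    t (X ⊗ Y) Z =
      ai X Y Z ∘ (idmor X ⊠ t Y Z) ∘ a X Y Z
      + ai X Y Z ∘ (idmor X ⊠ σi Y Z) ∘ a X Z Y ∘ (t X Z ⊠ idmor Y)
          ∘ ai X Z Y ∘ (idmor X ⊠ σ Y Z) ∘ a X Y Z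
}.

End Braided.

Arguments tensor_bilinear {R C} D.
Arguments t12 {R C} D t X Y Z.
Arguments t23 {R C} D t DP X Y Z.
Arguments is_pre_cartier {R C} D t.

Section HCat.
Variables (R : comNzRingType) (C : lincat R).

Definition hhom (X Y : C) : lmodType (fps R) := fps (Mor X Y).
Definition hidm (X : C) : hhom X X := hconst (idmor X).
Definition hcomp (X Y Z : C) (g : hhom Y Z) (f : hhom X Y) : hhom X Z :=
  cauchy mcomp g f.

Lemma mcomp0m (X Y Z : C) (f : Mor X Y) : (0 : Mor Y Z) ∘ f = 0.
Proof.
by have := mcomp_linearl (Z := Z) f (-1) 0 0; rewrite !scaleN1r !addNr.
Qed.
Lemma mcompm0 (X Y Z : C) (g : Mor Y Z) : g ∘ (0 : Mor X Y) = 0.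
Proof.
by have := mcomp_linearr (X := X) g (-1) 0 0; rewrite !scaleN1r !addNr.
Qed.
Lemma mcompDm (X Y Z : C) (f : Mor X Y) :
  {morph (fun g : Mor Y Z => g ∘ f) : g g' / g + g'}.
Proof.
by move=> g g'; have := mcomp_linearl f 1 g g'; rewrite !scale1r.
Qed.
Lemma mcompmD (X Y Z : C) (g : Mor Y Z) :
  {morph (fun f : Mor X Y => g ∘ f) : f f' / f + f'}.
Proof.
by move=> f f'; have := mcomp_linearr g 1 f f'; rewrite !scale1r.
Qed.

Fact hcomp1m (X Y : C) (f : hhom X Y) : hcomp (hidm Y) f = f.
Proof.
rewrite /hcomp cauchy_hconstl; last exact: mcomp0m.
by apply: funext => n; exact: mcomp1m.
Qed.
Fact hcompm1 (X Y : C) (f : hhom X Y) : hcomp f (hidm X) = f.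
Proof.
rewrite /hcomp cauchy_hconstr; last exact: mcompm0.
by apply: funext => n; exact: mcompm1.
Qed.
Fact hcompA (W X Y Z : C) (h : hhom Y Z) (g : hhom X Y) (f : hhom W X) :
  hcomp h (hcomp g f) = hcomp (hcomp h g) f.
Proof.
symmetry; apply: cauchyA; [exact: mcomp0m | exact: mcompDm | exact: mcompm0
  | exact: mcompmD | by move=> x y z; rewrite mcompA].
Qed.
Fact hcomp_linearl (X Y Z : C) (f : hhom X Y) :
  linear (fun g : hhom Y Z => hcomp g f).
Proof. by apply: cauchy_linearl => y; exact: mcomp_linearl. Qed.
Fact hcomp_linearr (X Y Z : C) (g : hhom Y Z) :
  linear (fun f : hhom X Y => hcomp g f).
Proof. by apply: cauchy_linearr => y; exact: mcomp_linearr. Qed.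

Definition hcat : lincat (fps R) :=
  LinCat hcomp1m hcompm1 hcompA hcomp_linearl hcomp_linearr.

(** The ħ-linear extension of a braided structure: [cauchy] of the tensor
    product on morphisms, constant series for the constraints. *)
Definition hdata (D : braided_data C) : braided_data hcat :=
  @BraidedData (fps R) hcat (tob D)
    (fun X X' Y Y' (f : hhom X X') (g : hhom Y Y') =>
       cauchy (tmor D) f g : hhom (tob D X Y) (tob D X' Y'))
    (unit_ob D)
    (fun X Y Z => hconst (assoc D X Y Z))
    (fun X => hconst (lunit D X))
    (fun X => hconst (runit D X))
    (fun X Y => hconst (braid D X Y)).

Lemma hdata_tensor_bilinear (D : braided_data C) :
  tensor_bilinear D -> tensor_bilinear (hdata D).
Proof.
move=> [Dl Dr]; split=> X X' Y Y' f.
  by apply: cauchy_linearl => y; exact: Dl.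
by apply: cauchy_linearr => y; exact: Dr.
Qed.

End HCat.

Section Deformation.
Variables (k : fieldType) (C : lincat k).

(** e^{ħ c f} = Σ_n (c^n / n!) f^n ħ^n. *)
Definition hexp (c : k) (X : C) (f : Mor X X) : @Mor _ (hcat C) X X :=
  fun n => (c ^+ n / n`!%:R) *: mpow f n.

Definition deformed_data (D : braided_data C)
    (t : forall X Y : C, Mor (tob D X Y) (tob D X Y)) : braided_data (hcat C) :=
  @BraidedData (fps k) (hcat C) (tob (hdata D)) (@tmor _ _ (hdata D))
    (unit_ob (hdata D)) (assoc (hdata D)) (lunit (hdata D)) (runit (hdata D))
    (fun X Y => braid (hdata D) X Y ∘ hexp 2%:R^-1 (t X Y)).

End Deformation.

Arguments deformed_data {k C} D t.

(* Main.v *)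
Require Import Defs.
From HB Require Import structures.
From mathcomp Require Import all_boot all_order all_algebra.
From mathcomp Require Import boolp ring.

Set Implicit Arguments.
Unset Strict Implicit.
Unset Printing Implicit Defensive.

Import GRing.Theory.
Local Open Scope ring_scope.
Local Open Scope lincat_scope.

(** Twisting the braiding by e^{ħt/2} leaves the associator, hence the pentagon
    and the triangle, alone; only the two hexagons have any content.

    On (X ⊗ Y) ⊗ Z write t12 and t23 for the two given adjacent actions of t,
    and let t13 and t13' be the two ways of letting the outer factors
    interact: bring X next to Z past Y by σ_{X,Y} and conjugate t23, or bring
    Z next to X past Y by σ_{Y,Z} and conjugate t12. Up to associators, the
    pre-Cartier axioms read t_{X,Y⊗Z} = t12 + t13 and t_{X⊗Y,Z} = t23 + t13'.
    Pulling the exponentials through the original hexagons reduces the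
    deformed ones to
      e^{ħ(t12 + t13)/2} = e^{ħ t13/2} e^{ħ t12/2}   and
      e^{ħ(t23 + t13')/2} = e^{ħ t13'/2} e^{ħ t23/2},
    which hold in characteristic zero as soon as t12 commutes with t13 and t23
    commutes with t13'.

    The infinitesimal braiding is not assumed to satisfy σ t = t σ, so neither
    commutation is a relabelling of the hypothesis [t12, t23] = 0. They follow
    from naturality of t, used three times:
    - against id ⊗ σ_{Y,Z}, where the contribution of t12 is carried around
      by naturality of σ ([t13_s23]), it gives t13 = t13' ([t13E]);
    - against id ⊗ t_{Y,Z}, it gives [t23, t12 + t13] = 0, hence
      [t23, t13] = 0 ([T23_t13]);
    - against t_{X,Y} ⊗ id, it gives [t12, t23 + t13'] = 0, hence
      [t12, t13'] = 0 ([T12_t13]).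
    By t13 = t13' the last two are the commutations needed. *)

(** * Isomorphisms *)

Section Isomorphisms.
Variables (R : comNzRingType) (C : lincat R).

Lemma iso_invl (X Y : C) (f : Mor X Y) (fi : is_iso f) :
  iso_inv fi ∘ f = idmor X.
Proof. by case: (iso_invP fi). Qed.

Lemma iso_invr (X Y : C) (f : Mor X Y) (fi : is_iso f) :
  f ∘ iso_inv fi = idmor Y.
Proof. by case: (iso_invP fi). Qed.

Lemma iso_compKl (W X Y : C) (f : Mor X Y) (fi : is_iso f) (g : Mor W X) :
  iso_inv fi ∘ (f ∘ g) = g.
Proof. by rewrite mcompA iso_invl mcomp1m. Qed.

Lemma iso_compKr (W X Y : C) (f : Mor X Y) (fi : is_iso f) (g : Mor W Y) :
  f ∘ (iso_inv fi ∘ g) = g.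
Proof. by rewrite mcompA iso_invr mcomp1m. Qed.

Lemma iso_monic (W X Y : C) (f : Mor X Y) (g h : Mor W X) :
  is_iso f -> f ∘ g = f ∘ h -> g = h.
Proof. by move=> fi e; rewrite -(iso_compKl fi g) e iso_compKl. Qed.

Lemma mcomp_square (V W X Y Z : C) (g : Mor Y Z) (f : Mor X Y)
    (g' : Mor W Z) (f' : Mor X W) (h : Mor V X) :
  g ∘ f = g' ∘ f' -> g ∘ (f ∘ h) = g' ∘ (f' ∘ h).
Proof. by rewrite !mcompA => ->. Qed.

Lemma iso_inv_unique (X Y : C) (f : Mor X Y) (fi : is_iso f) (g : Mor Y X) :
  f ∘ g = idmor Y -> iso_inv fi = g.
Proof. by move=> fg; rewrite -[g](iso_compKl fi) fg mcompm1. Qed.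

Lemma is_iso_comp (X Y Z : C) (g : Mor Y Z) (f : Mor X Y) :
  is_iso g -> is_iso f -> is_iso (g ∘ f).
Proof.
move=> gi fi; exists (iso_inv fi ∘ iso_inv gi); split.
  by rewrite -mcompA iso_compKl iso_invl.
by rewrite -mcompA iso_compKr iso_invr.
Qed.

End Isomorphisms.

(** * Constant power series and the extended braided structure *)

(** Composing a Cauchy product with a fixed morphism gives a Cauchy product again,
    so the naturality squares below can be compared coefficient by coefficient. *)
Lemma cauchy_additive (T1 T2 : Type) (V W : nmodType) (phi : V -> W)
    (m : T1 -> T2 -> V) (u : fps T1) (v : fps T2) n :
  phi 0 = 0 -> {morph phi : x y / x + y} ->
  phi (cauchy m u v n) = cauchy (fun x y => phi (m x y)) u v n.
Proof. by move=> phi0 phiD; rewrite /cauchy (big_morph phi phiD phi0). Qed.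

Lemma linear_map0 (R : comNzRingType) (U V : lmodType R) (f : U -> V) :
  linear f -> f 0 = 0.
Proof. by move=> fl; have := fl (-1) 0 0; rewrite !scaleN1r !addNr. Qed.

Lemma linear_mapD (R : comNzRingType) (U V : lmodType R) (f : U -> V) :
  linear f -> {morph f : x y / x + y}.
Proof. by move=> fl x y; have := fl 1 x y; rewrite !scale1r. Qed.

Lemma linear_mapZ (R : comNzRingType) (U V : lmodType R) (f : U -> V) a x :
  linear f -> f (a *: x) = a *: f x.
Proof. by move=> fl; have := fl a x 0; rewrite (linear_map0 fl) !addr0. Qed.

Section Constants.
Variables (R : comNzRingType) (C : lincat R).
Local Notation H := (hcat C).

(** [hconst], typed as a morphism of [hcat C] so that composition in that
    category is what applies to it. *)
Definition hcst (X Y : C) (f : Mor X Y) : @Mor _ H X Y := hconst f.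

Lemma hcst_compl (X Y Z : C) (g : Mor Y Z) (f : @Mor _ H X Y) :
  hcst g ∘ f = fun n => g ∘ f n.
Proof. by rewrite /= /hcomp cauchy_hconstl //; exact: mcomp0m. Qed.

Lemma hcst_compr (X Y Z : C) (g : @Mor _ H Y Z) (f : Mor X Y) :
  g ∘ hcst f = fun n => g n ∘ f.
Proof. by rewrite /= /hcomp cauchy_hconstr //; exact: mcompm0. Qed.

Lemma hcst_comp (X Y Z : C) (g : Mor Y Z) (f : Mor X Y) :
  hcst (g ∘ f) = hcst g ∘ hcst f.
Proof.
by rewrite hcst_compl; apply: funext => -[|n] //=; rewrite mcompm0.
Qed.

Lemma hcst_iso (X Y : C) (f : Mor X Y) : is_iso f -> is_iso (hcst f).
Proof.
by move=> fi; exists (hcst (iso_inv fi)); rewrite -!hcst_comp iso_invl iso_invr.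
Qed.

(** [iso_inv] is chosen from an existence proof, so the inverse in [hcat C] of
    a constant series is only known to be constant by uniqueness of inverses. *)
Lemma iso_inv_hcst (X Y : C) (f : Mor X Y) (fi : is_iso f)
    (hfi : is_iso (hcst f)) : iso_inv hfi = hcst (iso_inv fi).
Proof. by apply: iso_inv_unique; rewrite -hcst_comp iso_invr. Qed.

End Constants.

Section ExtendedBraided.
Variables (R : comNzRingType) (C : lincat R) (D : braided_data C).
Hypothesis Dbil : tensor_bilinear D.
Hypothesis DP : is_braided_monoidal D.
Local Notation H := (hcat C).
Local Notation "f ⊠ g" := (tmor D f g) (at level 38, left associativity).
Local Notation "f ⊠~ g" := (tmor (hdata D) f g) (at level 38, left associativity).
Local Notation "X ⊗ Y" := (tob D X Y) (at level 38, left associativity).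

Lemma tens_linl (X X' Y Y' : C) (g : Mor Y Y') :
  linear (fun f : Mor X X' => f ⊠ g).
Proof. exact: (proj1 Dbil). Qed.

Lemma tens_linr (X X' Y Y' : C) (f : Mor X X') :
  linear (fun g : Mor Y Y' => f ⊠ g).
Proof. exact: (proj2 Dbil). Qed.

Lemma tens0m (X X' Y Y' : C) (g : Mor Y Y') : (0 : Mor X X') ⊠ g = 0.
Proof. exact: (linear_map0 (@tens_linl X X' Y Y' g)). Qed.

Lemma tensm0 (X X' Y Y' : C) (f : Mor X X') : f ⊠ (0 : Mor Y Y') = 0.
Proof. exact: (linear_map0 (@tens_linr X X' Y Y' f)). Qed.

Lemma tensDm (X X' Y Y' : C) (g : Mor Y Y') :
  {morph (fun f : Mor X X' => f ⊠ g) : f f' / f + f'}.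
Proof. exact: (linear_mapD (@tens_linl X X' Y Y' g)). Qed.

Lemma tensmD (X X' Y Y' : C) (f : Mor X X') :
  {morph (fun g : Mor Y Y' => f ⊠ g) : g g' / g + g'}.
Proof. exact: (linear_mapD (@tens_linr X X' Y Y' f)). Qed.

Lemma htens_cstl (X X' Y Y' : C) (f : Mor X X') (g : @Mor _ H Y Y') :
  hcst f ⊠~ g = fun n => f ⊠ g n.
Proof. by rewrite /= cauchy_hconstl // => y; exact: tens0m. Qed.

Lemma htens_cstr (X X' Y Y' : C) (f : @Mor _ H X X') (g : Mor Y Y') :
  f ⊠~ hcst g = fun n => f n ⊠ g.
Proof. by rewrite /= cauchy_hconstr // => y; exact: tensm0. Qed.

Lemma htens_cst (X X' Y Y' : C) (f : Mor X X') (g : Mor Y Y') :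
  hcst f ⊠~ hcst g = hcst (f ⊠ g).
Proof.
by rewrite htens_cstl; apply: funext => -[|n] //=; exact: tensm0.
Qed.

Lemma htens_split (X X' Y Y' : C) (f : @Mor _ H X X') (g : @Mor _ H Y Y') :
  f ⊠~ g = (f ⊠~ hcst (idmor Y')) ∘ (hcst (idmor X) ⊠~ g).
Proof.
rewrite htens_cstl htens_cstr; apply: funext => n; apply: eq_bigr => i _ /=.
by rewrite -(tens_comp DP) mcompm1 mcomp1m.
Qed.

Lemma htens_split_op (X X' Y Y' : C) (f : @Mor _ H X X') (g : @Mor _ H Y Y') :
  f ⊠~ g = (hcst (idmor X') ⊠~ g) ∘ (f ⊠~ hcst (idmor Y)).
Proof.
rewrite htens_cstl htens_cstr /= /hcomp [RHS]cauchyC.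
apply: funext => n; apply: eq_bigr => i _ /=.
by rewrite -(tens_comp DP) mcompm1 mcomp1m.
Qed.

Lemma htens_compl (X X' X'' Y : C) (f' : @Mor _ H X' X'') (f : @Mor _ H X X') :
  (f' ∘ f) ⊠~ hcst (idmor Y) =
    (f' ⊠~ hcst (idmor Y)) ∘ (f ⊠~ hcst (idmor Y)).
Proof.
rewrite !htens_cstr; apply: funext => n /=; rewrite /hcomp.
rewrite (cauchy_additive (phi := fun f => f ⊠ idmor Y)).
- by apply: eq_bigr => i _; rewrite -(tens_comp DP) mcompm1.
- exact: tens0m.
- exact: tensDm.
Qed.

Lemma htens_compr (X Y Y' Y'' : C) (g' : @Mor _ H Y' Y'') (g : @Mor _ H Y Y') :
  hcst (idmor X) ⊠~ (g' ∘ g) =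
    (hcst (idmor X) ⊠~ g') ∘ (hcst (idmor X) ⊠~ g).
Proof.
rewrite !htens_cstl; apply: funext => n /=; rewrite /hcomp.
rewrite (cauchy_additive (phi := fun f => idmor X ⊠ f)).
- by apply: eq_bigr => i _; rewrite -(tens_comp DP) mcompm1.
- exact: tensm0.
- exact: tensmD.
Qed.

(** Interchange follows from functoriality in each variable separately and from
    the two factorizations of a tensor product of morphisms, so no fourfold
    Cauchy product has to be rearranged. *)
Lemma htens_comp (X X' X'' Y Y' Y'' : C)
    (f' : @Mor _ H X' X'') (f : @Mor _ H X X')
    (g' : @Mor _ H Y' Y'') (g : @Mor _ H Y Y') :
  (f' ∘ f) ⊠~ (g' ∘ g) = (f' ⊠~ g') ∘ (f ⊠~ g).
Proof.
rewrite htens_split htens_compl htens_compr [f' ⊠~ g']htens_split.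
rewrite [f ⊠~ g]htens_split -!mcompA; congr (_ ∘ _); rewrite !mcompA.
by congr (_ ∘ _); rewrite -htens_split -htens_split_op.
Qed.

Lemma hassoc_nat (X X' Y Y' Z Z' : C)
    (f : @Mor _ H X X') (g : @Mor _ H Y Y') (h : @Mor _ H Z Z') :
  hcst (assoc D X' Y' Z') ∘ ((f ⊠~ g) ⊠~ h) =
    (f ⊠~ (g ⊠~ h)) ∘ hcst (assoc D X Y Z).
Proof.
rewrite hcst_compl hcst_compr; apply: funext => n /=.
rewrite (cauchy_additive (phi := fun f => assoc D X' Y' Z' ∘ f));
  [|exact: mcompm0|exact: mcompmD].
rewrite (cauchy_additive (phi := fun f => f ∘ assoc D X Y Z));
  [|exact: mcomp0m|exact: mcompDm].
congr (_ n); apply: cauchyA.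
- by move=> z; rewrite tens0m mcompm0.
- by move=> z x y; rewrite tensDm mcompmD.
- by move=> x; rewrite tensm0 mcomp0m.
- by move=> x y z; rewrite tensmD mcompDm.
- by move=> x y z; exact: (assoc_nat DP).
Qed.

Lemma hbraid_nat (X X' Y Y' : C) (f : @Mor _ H X X') (g : @Mor _ H Y Y') :
  hcst (braid D X' Y') ∘ (f ⊠~ g) = (g ⊠~ f) ∘ hcst (braid D X Y).
Proof.
rewrite hcst_compl hcst_compr; apply: funext => n /=.
rewrite (cauchy_additive (phi := fun f => braid D X' Y' ∘ f));
  [|exact: mcompm0|exact: mcompmD].
rewrite (cauchy_additive (phi := fun f => f ∘ braid D X Y));
  [|exact: mcomp0m|exact: mcompDm].
rewrite [in RHS]cauchyC; apply: eq_bigr => i _; exact: (braid_nat DP).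
Qed.

End ExtendedBraided.

(** * Exponentials of endomorphisms *)

Section EndomorphismRing.
Variables (R : comNzRingType) (C : lincat R) (X : C).

(** Endomorphisms as a ring, possibly trivial since X may be a zero object; this
    gives access to the binomial formula for commuting elements. *)
Definition endo : Type := Mor X X.
HB.instance Definition _ := GRing.Zmodule.copy endo (Mor X X).

Fact endo_mulA : associative (fun f g : endo => f ∘ g : endo).
Proof. by move=> f g h; exact: mcompA. Qed.
Fact endo_mul1 : left_id (idmor X : endo) (fun f g : endo => f ∘ g).
Proof. by move=> f; exact: mcomp1m. Qed.
Fact endo_mulr1 : right_id (idmor X : endo) (fun f g : endo => f ∘ g).
Proof. by move=> f; exact: mcompm1. Qed.
Fact endo_mulDl : left_distributive (fun f g : endo => f ∘ g : endo) +%R.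
Proof. by move=> f g h; exact: mcompDm. Qed.
Fact endo_mulDr : right_distributive (fun f g : endo => f ∘ g : endo) +%R.
Proof. by move=> f g h; exact: mcompmD. Qed.

HB.instance Definition _ := GRing.Zmodule_isPzRing.Build endo
  endo_mulA endo_mul1 endo_mulr1 endo_mulDl endo_mulDr.

Lemma mpowE (f : Mor X X) n : mpow f n = (f : endo) ^+ n.
Proof. by elim: n => // n IH; rewrite exprS -IH. Qed.

End EndomorphismRing.

Lemma mcompZm (R : comNzRingType) (C : lincat R) (X Y Z : C) c
    (g : Mor Y Z) (f : Mor X Y) : (c *: g) ∘ f = c *: (g ∘ f).
Proof. exact: (linear_mapZ c g (mcomp_linearl f)). Qed.

Lemma mcompmZ (R : comNzRingType) (C : lincat R) (X Y Z : C) c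
    (g : Mor Y Z) (f : Mor X Y) : g ∘ (c *: f) = c *: (g ∘ f).
Proof. exact: (linear_mapZ c f (mcomp_linearr g)). Qed.

Lemma mcompmN (R : comNzRingType) (C : lincat R) (X Y Z : C)
    (g : Mor Y Z) (f : Mor X Y) : g ∘ (- f) = - (g ∘ f).
Proof. by rewrite -scaleN1r mcompmZ scaleN1r. Qed.

Lemma mcompNm (R : comNzRingType) (C : lincat R) (X Y Z : C)
    (g : Mor Y Z) (f : Mor X Y) : (- g) ∘ f = - (g ∘ f).
Proof. by rewrite -scaleN1r mcompZm scaleN1r. Qed.

Section Exponential.
Variables (k : fieldType) (C : lincat k).
Local Notation H := (hcat C).

(** Homomorphisms of endomorphism algebras commute with the exponential; applied
    below to the functors id ⊗ - and - ⊗ id. *)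
Lemma hexp_morph (X Y : C) (c : k) (phi : Mor X X -> Mor Y Y) (f : Mor X X) :
  linear phi -> phi (idmor X) = idmor Y ->
  (forall g h, phi (g ∘ h) = phi g ∘ phi h) ->
  (fun n => phi (hexp c f n)) = hexp c (phi f).
Proof.
move=> phil phi1 phiM; apply: funext => n.
rewrite /hexp linear_mapZ //; congr (_ *: _).
by elim: n => //= n <-.
Qed.

Lemma hexp_intertwine_coef (X Y : C) (c : k) (h : Mor X Y)
    (f : Mor X X) (g : Mor Y Y) n :
  h ∘ f = g ∘ h -> h ∘ hexp c f n = hexp c g n ∘ h.
Proof.
move=> hf; rewrite /hexp mcompmZ mcompZm; congr (_ *: _).
elim: n => [|n IH] /=; first by rewrite mcompm1 mcomp1m.
by rewrite mcompA hf -mcompA IH mcompA.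
Qed.

Lemma hexp_intertwine (X Y : C) (c : k) (h : Mor X Y)
    (f : Mor X X) (g : Mor Y Y) :
  h ∘ f = g ∘ h -> hcst h ∘ hexp c f = hexp c g ∘ hcst h.
Proof.
move=> hf; rewrite hcst_compl hcst_compr; apply: funext => n.
exact: hexp_intertwine_coef.
Qed.

Lemma hexp0 (X : C) (c : k) : hexp c (0 : Mor X X) = idmor (X : H).
Proof.
apply: funext => -[|n]; rewrite /hexp /=.
  by rewrite expr0 fact0 divr1 scale1r.
by rewrite mcomp0m scaler0.
Qed.

Hypothesis char_k : [pchar k] =i pred0.

(** The coefficient of ħ^n is the binomial formula divided by n!, which is where
    characteristic zero is needed. *)
Lemma hexpD (X : C) (c : k) (f g : Mor X X) :
  f ∘ g = g ∘ f -> hexp c (f + g) = hexp c f ∘ hexp c g.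
Proof.
move=> fg; apply: funext => n; rewrite /= /hcomp /cauchy /hexp mpowE.
have gf : GRing.comm (g : endo X) f by rewrite /GRing.comm; symmetry.
have ffact m : m`!%:R != 0 :> k by rewrite (pcharf0P k).1 // -lt0n fact_gt0.
rewrite addrC (exprDn_comm n gf) scaler_sumr; apply: eq_bigr => i _.
have le_in : (i <= n)%N by rewrite -ltnS.
have -> : (g : endo X) ^+ (n - i) * (f : endo X) ^+ i
    = mpow f i ∘ mpow g (n - i).
  by rewrite !mpowE (commrX _ (commr_sym (commrX _ (commr_sym gf)))).
rewrite mcompZm mcompmZ scalerA -scaler_nat scalerA; congr (_ *: _).
rewrite -(bin_fact le_in) !natrM -{1}(subnKC le_in) exprD.
have bn0 : ('C(n, i))%:R != 0 :> k by rewrite (pcharf0P k).1 // -lt0n bin_gt0.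
by field; rewrite bn0 !ffact.
Qed.

Lemma hexpN (X : C) (c : k) (f : Mor X X) :
  hexp c f ∘ hexp c (- f) = idmor (X : H).
Proof. by rewrite -hexpD ?subrr ?hexp0 // mcompmN mcompNm. Qed.

Lemma hexp_iso (X : C) (c : k) (f : Mor X X) : is_iso (hexp c f).
Proof.
by exists (hexp c (- f)); rewrite hexpN -{2}[f]opprK hexpN.
Qed.

End Exponential.

(** * Infinitesimal braid relations *)

Section InfinitesimalBraid.
Variables (R : comNzRingType) (C : lincat R) (D : braided_data C).
Variable t : forall X Y : C, Mor (tob D X Y) (tob D X Y).
Hypothesis Ct : is_pre_cartier D t.
Local Notation "X ⊗ Y" := (tob D X Y) (at level 38, left associativity).
Local Notation "f ⊠ g" := (tmor D f g) (at level 38, left associativity).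
Local Notation a := (assoc D).
Local Notation σ := (braid D).
Local Notation DP := (pc_braided Ct).
Local Notation ai X Y Z := (iso_inv (assoc_iso DP X Y Z)).
Local Notation σi X Y := (iso_inv (braid_iso DP X Y)).
Local Notation T12 := (t12 D t).
Local Notation T23 := (t23 D t DP).

(** The braid generators on left-bracketed triple products. *)
Definition s12 (X Y Z : C) : Mor (X ⊗ Y ⊗ Z) (Y ⊗ X ⊗ Z) := σ X Y ⊠ idmor Z.

Definition s23 (X Y Z : C) : Mor (X ⊗ Y ⊗ Z) (X ⊗ Z ⊗ Y) :=
  ai X Z Y ∘ (idmor X ⊠ σ Y Z) ∘ a X Y Z.

(** Interaction of the outer factors after X has been moved past Y. *)
Definition t13 (X Y Z : C) : Mor (X ⊗ Y ⊗ Z) (X ⊗ Y ⊗ Z) :=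
  (σi X Y ⊠ idmor Z) ∘ T23 Y X Z ∘ s12 X Y Z.

(** Interaction of the outer factors after Z has been moved past Y. *)
Definition t13' (X Y Z : C) : Mor (X ⊗ Y ⊗ Z) (X ⊗ Y ⊗ Z) :=
  ai X Y Z ∘ (idmor X ⊠ σi Y Z) ∘ a X Z Y ∘ T12 X Z Y ∘ s23 X Y Z.

Lemma s12K (X Y Z : C) : s12 X Y Z ∘ (σi X Y ⊠ idmor Z) = idmor _.
Proof. by rewrite /s12 -(tens_comp DP) iso_invr mcomp1m (tens_id DP). Qed.

Lemma s12_t13 (X Y Z : C) : s12 X Y Z ∘ t13 X Y Z = T23 Y X Z ∘ s12 X Y Z.
Proof. by rewrite /t13 !mcompA s12K mcomp1m. Qed.

Lemma s23K (X Y Z : C) :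
  s23 X Y Z ∘ (ai X Y Z ∘ (idmor X ⊠ σi Y Z) ∘ a X Z Y) = idmor _.
Proof.
rewrite /s23 -!mcompA iso_compKr [(idmor X ⊠ σ Y Z) ∘ _]mcompA -(tens_comp DP).
by rewrite iso_invr mcomp1m (tens_id DP) mcomp1m iso_invl.
Qed.

Lemma s23_iso (X Y Z : C) : is_iso (s23 X Y Z).
Proof.
exists (ai X Y Z ∘ (idmor X ⊠ σi Y Z) ∘ a X Z Y); split; last exact: s23K.
rewrite /s23 -!mcompA iso_compKr [(idmor X ⊠ σi Y Z) ∘ _]mcompA -(tens_comp DP).
by rewrite iso_invl mcomp1m (tens_id DP) mcomp1m iso_invl.
Qed.

Lemma s23_t13' (X Y Z : C) : s23 X Y Z ∘ t13' X Y Z = T12 X Z Y ∘ s23 X Y Z.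
Proof. by rewrite /t13' 2!(mcompA (s23 X Y Z)) s23K mcomp1m. Qed.

Lemma t_tens_r (X Y Z : C) :
  t X (Y ⊗ Z) ∘ a X Y Z = a X Y Z ∘ (T12 X Y Z + t13 X Y Z).
Proof.
rewrite (pc_tens_r Ct) mcompDm mcompmD /t13 /t23 /s12 /t12.
by rewrite -!mcompA iso_invl !mcompm1.
Qed.

Lemma t_tens_l (X Y Z : C) : t (X ⊗ Y) Z = T23 X Y Z + t13' X Y Z.
Proof. by rewrite (pc_tens_l Ct) /t13' /t23 /s23 /t12 -!mcompA. Qed.

Lemma T23_assoc (X Y Z : C) : a X Y Z ∘ T23 X Y Z = (idmor X ⊠ t Y Z) ∘ a X Y Z.
Proof. by rewrite /t23 -!mcompA iso_compKr. Qed.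

Lemma s23_assoc (X Y Z : C) : a X Z Y ∘ s23 X Y Z = (idmor X ⊠ σ Y Z) ∘ a X Y Z.
Proof. by rewrite /s23 -!mcompA iso_compKr. Qed.

Lemma braid_tens_l (X Y Z : C) :
  s12 X Z Y ∘ s23 X Y Z = ai Z X Y ∘ σ (X ⊗ Y) Z.
Proof.
by rewrite /s23 !mcompA -(hexagon2 DP) -!mcompA iso_invl mcompm1.
Qed.

(** Moving Z to the front by s12 s23 is, up to an associator, the braiding of
    X ⊗ Y with Z, which carries t_{X,Y} along by naturality. *)
Lemma s12_s23_T12 (X Y Z : C) :
  T23 Z X Y ∘ (s12 X Z Y ∘ s23 X Y Z) = s12 X Z Y ∘ s23 X Y Z ∘ T12 X Y Z.
Proof.
rewrite braid_tens_l /t12 -mcompA (braid_nat DP).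
by rewrite mcompA /t23 -!mcompA iso_compKr.
Qed.

(** Cancelling s12 from [s12_s23_T12], since s12 conjugates t13 into t23. *)
Lemma t13_s23 (X Y Z : C) : t13 X Z Y ∘ s23 X Y Z = s23 X Y Z ∘ T12 X Y Z.
Proof.
have s12_iso : is_iso (s12 X Z Y).
  exists (σi X Z ⊠ idmor Y); split; last exact: s12K.
  by rewrite /s12 -(tens_comp DP) iso_invl mcomp1m (tens_id DP).
by apply: (iso_monic s12_iso); rewrite mcompA s12_t13 -mcompA s12_s23_T12 mcompA.
Qed.

(** Naturality of t_{X,-} against σ_{Y,Z} says that s23 intertwines t12 + t13
    with itself: s23 t12 + s23 t13 = t12 s23 + t13 s23. The last term is s23 t12
    by [t13_s23], so s23 t13 = t12 s23, which also characterizes t13'. *)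
Lemma t13E (X Y Z : C) : t13 X Y Z = t13' X Y Z.
Proof.
apply: (iso_monic (s23_iso X Y Z)); rewrite s23_t13'.
(* Adding s23 t12 to both sides completes the two halves of the sum. *)
apply: (addrI (s23 X Y Z ∘ T12 X Y Z)).
rewrite -mcompmD -t13_s23 [in RHS]addrC -mcompDm.
apply: (iso_monic (assoc_iso DP X Z Y)).
rewrite [LHS]mcompA s23_assoc -[LHS]mcompA -t_tens_r.
rewrite [RHS]mcompA -t_tens_r -[RHS]mcompA s23_assoc !mcompA.
by rewrite (pc_nat Ct).
Qed.

Hypothesis t12_t23 : forall X Y Z : C,
  mcommutator (T12 X Y Z) (T23 X Y Z) = 0.

Lemma T12_T23 (X Y Z : C) : T12 X Y Z ∘ T23 X Y Z = T23 X Y Z ∘ T12 X Y Z.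
Proof. by apply/eqP; rewrite -subr_eq0; apply/eqP; exact: t12_t23. Qed.

(** Naturality of t_{X,-} against t_{Y,Z} makes t23 commute with t12 + t13. *)
Lemma T23_t13 (X Y Z : C) : T23 X Y Z ∘ t13 X Y Z = t13 X Y Z ∘ T23 X Y Z.
Proof.
apply: (addrI (T12 X Y Z ∘ T23 X Y Z)); rewrite -mcompDm {1}T12_T23 -mcompmD.
apply: (iso_monic (assoc_iso DP X Y Z)).
rewrite [LHS]mcompA T23_assoc -[LHS]mcompA -t_tens_r.
rewrite [RHS]mcompA -t_tens_r -[RHS]mcompA T23_assoc !mcompA.
by rewrite (pc_nat Ct).
Qed.

(** Naturality of t_{-,Z} against t_{X,Y} makes t12 commute with t23 + t13',
    and t13' = t13. *)
Lemma T12_t13 (X Y Z : C) : T12 X Y Z ∘ t13 X Y Z = t13 X Y Z ∘ T12 X Y Z.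
Proof.
apply: (addrI (T23 X Y Z ∘ T12 X Y Z)); rewrite -mcompDm -{1}T12_T23 -mcompmD.
by rewrite t13E -t_tens_l /t12 (pc_nat Ct).
Qed.

End InfinitesimalBraid.

(** * The deformed hexagons *)

Section DeformedHexagons.
Variables (k : fieldType) (C : lincat k) (D : braided_data C).
Hypothesis char_k : [pchar k] =i pred0.
Variable t : forall X Y : C, Mor (tob D X Y) (tob D X Y).
Hypothesis Ct : is_pre_cartier D t.
Local Notation H := (hcat C).
Local Notation DP := (pc_braided Ct).
Local Notation Dbil := (pc_bilinear Ct).
Local Notation T12 := (t12 D t).
Local Notation T23 := (t23 D t DP).
Hypothesis t12_t23 : forall X Y Z : C,
  mcommutator (T12 X Y Z) (T23 X Y Z) = 0.
Local Notation "X ⊗ Y" := (tob D X Y) (at level 38, left associativity).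
Local Notation "f ⊠ g" := (tmor D f g) (at level 38, left associativity).
Local Notation "f ⊠~ g" := (tmor (hdata D) f g) (at level 38, left associativity).
Local Notation a := (assoc D).
Local Notation σ := (braid D).
Local Notation e f := (hexp 2%:R^-1 f).

Lemma hexp_tensl (X Y : C) (c : k) (f : Mor X X) :
  hexp c f ⊠~ hcst (idmor Y) = hexp c (f ⊠ idmor Y).
Proof.
rewrite (htens_cstr Dbil); apply: (hexp_morph c (phi := fun f => f ⊠ idmor Y)).
- exact: (tens_linl Dbil).
- exact: (tens_id DP).
- by move=> g h; rewrite -(tens_comp DP) mcompm1.
Qed.

Lemma hexp_tensr (X Y : C) (c : k) (f : Mor X X) :
  hcst (idmor Y) ⊠~ hexp c f = hexp c (idmor Y ⊠ f).
Proof.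
rewrite (htens_cstl Dbil); apply: (hexp_morph c (phi := fun f => idmor Y ⊠ f)).
- exact: (tens_linr Dbil).
- exact: (tens_id DP).
- by move=> g h; rewrite -(tens_comp DP) mcompm1.
Qed.

Lemma hbraid_tensl (X Y Z : C) :
  (hcst (σ X Y) ∘ e (t X Y)) ⊠~ hcst (idmor Z)
    = hcst (s12 D X Y Z) ∘ e (T12 X Y Z).
Proof. by rewrite (htens_compl Dbil DP) hexp_tensl (htens_cst Dbil). Qed.

Lemma hbraid_tensr (X Y Z : C) :
  hcst (idmor X) ⊠~ (hcst (σ Y Z) ∘ e (t Y Z))
    = hcst (idmor X ⊠ σ Y Z) ∘ e (idmor X ⊠ t Y Z).
Proof. by rewrite (htens_compr Dbil DP) hexp_tensr (htens_cst Dbil). Qed.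

(** Both sides equal the original hexagon followed by e^{ħ t13/2} e^{ħ t12/2}: on the
    left by splitting the exponential of t12 + t13, on the right by moving the
    exponential of t23 through s12, which turns it into that of t13. *)
Lemma deformed_hexagon1 (X Y Z : C) :
  hcst (a Y Z X) ∘ (hcst (σ X (Y ⊗ Z)) ∘ e (t X (Y ⊗ Z))) ∘ hcst (a X Y Z) =
    (hcst (idmor Y) ⊠~ (hcst (σ X Z) ∘ e (t X Z))) ∘ hcst (a Y X Z)
      ∘ ((hcst (σ X Y) ∘ e (t X Y)) ⊠~ hcst (idmor Z)).
Proof.
have t_a := hexp_intertwine 2%:R^-1 (esym (t_tens_r Ct X Y Z)).
have T23_a := hexp_intertwine 2%:R^-1 (T23_assoc Ct Y X Z).
have t13_s12 := hexp_intertwine 2%:R^-1 (s12_t13 Ct X Y Z).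
rewrite hbraid_tensl hbraid_tensr -!mcompA -t_a.
rewrite addrC hexpD //; last by rewrite (T12_t13 t12_t23).
rewrite -(mcomp_square _ T23_a) -(mcomp_square _ t13_s12) !mcompA.
by rewrite -!hcst_comp (hexagon1 DP).
Qed.

(** As for the other hexagon, with t23 + t13' split on the left; the exponential
    of t12 on the right is the one of t13' moved through s23. *)
Lemma deformed_hexagon2 (X Y Z : C) :
  hcst (iso_inv (assoc_iso DP Z X Y)) ∘ (hcst (σ (X ⊗ Y) Z) ∘ e (t (X ⊗ Y) Z))
      ∘ hcst (iso_inv (assoc_iso DP X Y Z)) =
    ((hcst (σ X Z) ∘ e (t X Z)) ⊠~ hcst (idmor Y))
      ∘ hcst (iso_inv (assoc_iso DP X Z Y))
      ∘ (hcst (idmor X) ⊠~ (hcst (σ Y Z) ∘ e (t Y Z))).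
Proof.
have T23_ai : iso_inv (assoc_iso DP X Y Z) ∘ (idmor X ⊠ t Y Z)
    = T23 X Y Z ∘ iso_inv (assoc_iso DP X Y Z).
  by rewrite /t23 -!mcompA iso_invr mcompm1.
have T23_ai' := hexp_intertwine 2%:R^-1 T23_ai.
have t13_s23 := hexp_intertwine 2%:R^-1 (s23_t13' Ct X Y Z).
have ai_σ : hcst (iso_inv (assoc_iso DP Z X Y)) ∘ hcst (σ (X ⊗ Y) Z)
    = hcst (s12 D X Z Y) ∘ hcst (s23 Ct X Y Z).
  by rewrite -!hcst_comp braid_tens_l.
have s23_ai : hcst (s23 Ct X Y Z) ∘ hcst (iso_inv (assoc_iso DP X Y Z))
    = hcst (iso_inv (assoc_iso DP X Z Y)) ∘ hcst (idmor X ⊠ σ Y Z).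
  by rewrite -!hcst_comp /s23 -[in LHS]mcompA iso_invr mcompm1.
rewrite (t_tens_l Ct) addrC hexpD //; last first.
  by rewrite -(t13E Ct) (T23_t13 t12_t23).
rewrite hbraid_tensl hbraid_tensr -!mcompA.
rewrite -T23_ai' (mcomp_square _ ai_σ) (mcomp_square _ t13_s23).
by rewrite (mcomp_square _ s23_ai).
Qed.

(** Naturality of t passes to its powers, hence to every pair of coefficients. *)
Lemma hexp_t_nat (X X' Y Y' : C) (c : k)
    (f : @Mor _ H X X') (g : @Mor _ H Y Y') :
  hexp c (t X' Y') ∘ (f ⊠~ g) = (f ⊠~ g) ∘ hexp c (t X Y).
Proof.
rewrite /= /hcomp [RHS]cauchyC; apply: funext => n; apply: eq_bigr => i _ /=.
rewrite (cauchy_additive (phi := fun f => hexp c (t X' Y') i ∘ f));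
  [|exact: mcompm0|exact: mcompmD].
rewrite (cauchy_additive (phi := fun f => f ∘ hexp c (t X Y) i));
  [|exact: mcomp0m|exact: mcompDm].
apply: eq_bigr => j _; symmetry; apply: hexp_intertwine_coef.
by rewrite (pc_nat Ct).
Qed.

End DeformedHexagons.

Theorem theorem4p12 (k : fieldType) (char_k : [pchar k] =i pred0)
    (C : lincat k) (D : braided_data C)
    (t : forall X Y : C, Mor (tob D X Y) (tob D X Y))
    (Ct : is_pre_cartier D t)
    (t12_t23 : forall X Y Z : C,
       mcommutator (t12 D t X Y Z) (t23 D t (pc_braided Ct) X Y Z) = 0) :
  is_braided_monoidal (deformed_data D t).
Proof.
have Dbil := pc_bilinear Ct.
pose DP := pc_braided Ct.
have ai X Y Z : is_iso (assoc (deformed_data D t) X Y Z).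
  exact: hcst_iso (assoc_iso DP X Y Z).
have aiE X Y Z : iso_inv (ai X Y Z) = hcst (iso_inv (assoc_iso DP X Y Z)).
  exact: iso_inv_hcst.
apply: (@IsBraidedMonoidal _ _ _ _ _ _ ai).
- by move=> X Y; rewrite [LHS](htens_cst Dbil) (tens_id DP).
- by move=> *; exact: (htens_comp Dbil DP).
- by move=> *; exact: (hassoc_nat Dbil DP).
- move=> X X' f; rewrite [X in _ ∘ X = _](htens_cstl Dbil).
  rewrite [LHS]hcst_compl [RHS]hcst_compr; apply: funext => n.
  exact: (lunit_nat DP).
- by move=> X; exact: hcst_iso (lunit_iso DP X).
- move=> X X' f; rewrite [X in _ ∘ X = _](htens_cstr Dbil).
  rewrite [LHS]hcst_compl [RHS]hcst_compr; apply: funext => n.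
  exact: (runit_nat DP).
- by move=> X; exact: hcst_iso (runit_iso DP X).
- move=> W X Y Z; have := congr1 (@hcst _ C _ _) (pentagon DP W X Y Z).
  by rewrite !hcst_comp -!(htens_cst Dbil).
- move=> X Y; have := congr1 (@hcst _ C _ _) (triangle DP X Y).
  by rewrite hcst_comp -!(htens_cst Dbil).
- move=> X X' Y Y' f g; rewrite -[LHS]mcompA (hexp_t_nat Ct).
  by rewrite mcompA [X in X ∘ _](hbraid_nat DP) -mcompA.
- move=> X Y; apply: is_iso_comp; first exact: hcst_iso (braid_iso DP X Y).
  exact: hexp_iso.
- exact: (deformed_hexagon1 char_k t12_t23).
- by move=> X Y Z; rewrite !aiE; exact: (deformed_hexagon2 char_k t12_t23).
Qed.
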